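(* There is a one-to-one correspondence between Manin triples of perm algebras associated to nondegenerate symmetric left-invariant bilinear forms and Manin triples of special apre-perm algebras.
   Context: All vector spaces and algebras are finite-dimensional over an algebraically closed field $\mathbb K$ of characteristic zero. For a vector space $A$ with dual space $A^*$, $\mathcal B_d$ denotes the nondegenerate symmetric bilinear form on $A\oplus A^*$ given by $\mathcal B_d(x+a^*,y+b^* )=\langle x,b^*\rangle+\langle a^*,y\rangle$ for all $x,y\in A$, $a^*,b^*\in A^*$. A perm algebra $(A,\circ_A)$ is a vector space $A$ with a bilinear operation $\circ_A$ satisfying $x\circ_A(y\circ_A z)=(x\circ_A y)\circ_A z=(y\circ_A x)\circ_A z$ for all $x,y,z\in A$. A bilinear form $\mathcal B$ on it is left-invariant if $\mathcal B(x\circ_A y,z)=\mathcal B(y,x\circ_A z)$ for all $x,y,z\in A$. An apre-perm algebra $(A,\triangleright_A,\triangleleft_A)$ is a vector space $A$ with multiplications $\triangleright_A,\triangleleft_A:A\otimes A\to A$ such that, setting $x\circ_A y=x\triangleright_A y+x\triangleleft_A y$ and $x\bullet_A y=x\triangleright_A y+y\triangleleft_A x$, $(A,\circ_A)$ is a perm algebra (called the associated perm algebra) and for all $x,y,z\in A$: $(x\circ_A y)\bullet_A z=x\bullet_A(y\bullet_A z)=y\bullet_A(x\bullet_A z)$ and $z\triangleleft_A(x\circ_A y)=-(z\triangleleft_A y)\triangleleft_A x=x\bullet_A(z\triangleleft_A y)=(x\bullet_A z)\triangleleft_A y$. It is called special if $\triangleleft_A$ is commutative. A quadratic special apre-perm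 algebra $(A,\triangleright_A,\triangleleft_A,\mathcal B)$ is a special apre-perm algebra $(A,\triangleright_A,\triangleleft_A)$ together with a nondegenerate symmetric bilinear form $\mathcal B$ that is invariant, that is, $\mathcal B(x\triangleleft_A y,z)=-\mathcal B(x,z\circ_A y)$ for all $x,y,z\in A$. A Manin triple of perm algebras associated to the nondegenerate symmetric left-invariant bilinear form $\mathcal B_d$, written $\big((A\oplus A^*,\circ_d,\mathcal B_d),(A,\circ_A),(A^*,\circ_{A^*})\big)$, consists of perm algebras $(A,\circ_A)$ and $(A^*,\circ_{A^*})$ and a perm algebra structure $(A\oplus A^*,\circ_d)$ on $A\oplus A^*$ containing both as perm subalgebras, such that $\mathcal B_d$ is left-invariant on $(A\oplus A^*,\circ_d)$. A Manin triple of special apre-perm algebras (associated to the nondegenerate symmetric invariant bilinear form $\mathcal B_d$), written $\big((A\oplus A^*,\triangleright_d,\triangleleft_d,\mathcal B_d),(A,\triangleright_A,\triangleleft_A),(A^*,\triangleright_{A^*},\triangleleft_{A^*})\big)$, consists of special apre-perm algebras $(A,\triangleright_A,\triangleleft_A)$ and $(A^*,\triangleright_{A^*},\triangleleft_{A^*})$ and a quadratic special apre-perm algebra structure $(A\oplus A^*,\triangleright_d,\triangleleft_d,\mathcal B_d)$ on $A\oplus A^*$ containing both as special apre-perm subalgebras. *)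

(* Defs.v *)
From HB Require Import structures.
From mathcomp Require Import all_boot all_order all_algebra.
From mathcomp Require Import sesquilinear.

Set Implicit Arguments.
Unset Strict Implicit.
Unset Printing Implicit Defensive.

Import GRing.Theory.
Local Open Scope ring_scope.

(* A bilinear multiplication on V is encoded as a curried linear map; thus
   multiplications can be added as elements of a vector space, and two
   multiplications with the same values are equal. *)
Notation "''Mul' ( V )" := ('Hom(V, 'Hom(V, V)))
  (at level 8, format "''Mul' ( V )") : type_scope.

Section Algebras.
Variables (K : fieldType) (V : vectType K).
Implicit Types (o r l : 'Mul(V)) (x y z : V).

Definition perm_axiom o : Prop :=
  forall x y z, o x (o y z) = o (o x y) z /\ o (o x y) z = o (o y x) z.

Record permAlgebra := PermAlgebra {
  perm_mul : 'Mul(V);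
  perm_mulP : perm_axiom perm_mul }.

(* Below, r and l stand for the multiplications written as a right-pointing
   and a left-pointing triangle respectively: the first is r x y, the second
   l x y. *)
Definition assoc_mul r l : 'Mul(V) := r + l.

Definition bullet r l x y : V := r x y + l y x.

Definition apre_perm_axiom r l : Prop :=
  let o := assoc_mul r l in
  let b := bullet r l in
  perm_axiom o /\
  forall x y z,
    [/\ b (o x y) z = b x (b y z),
        b x (b y z) = b y (b x z),
        l z (o x y) = - l (l z y) x,
        - l (l z y) x = b x (l z y)
      & b x (l z y) = l (b x z) y].

Record specialApre := SpecialApre {
  rtri : 'Mul(V);
  ltri : 'Mul(V);
  specialApre_axiom : apre_perm_axiom rtri ltri;
  ltri_comm : forall x y, ltri x y = ltri y x }.

Definition circ (P : specialApre) : 'Mul(V) := assoc_mul (rtri P) (ltri P).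

Definition left_invariant (o : 'Mul(V)) (B : {symmetric V}) : Prop :=
  forall x y z, B (o x y) z = B y (o x z).

Definition apre_invariant (P : specialApre) (B : {symmetric V}) : Prop :=
  forall x y z, B (ltri P x y) z = - B x (circ P z y).

Definition quadratic (P : specialApre) (B : {symmetric V}) : Prop :=
  nondegenerate B /\ apre_invariant P B.
End Algebras.

Definition mul_compat (K : fieldType) (U V : vectType K) (i : U -> V)
    (mU : 'Mul(U)) (mV : 'Mul(V)) : Prop :=
  forall x y, i (mU x y) = mV (i x) (i y).

Section Double.
Variables (K : fieldType) (A : vectType K).

Local Notation A' := 'Hom(A, K^o).
Local Notation D := (A * A')%type.

Definition Bd (u v : D) : K := v.2 u.1 + u.2 v.1.

Lemma Bd_bilinear :
  bilinear_for (GRing.Scale.Law.clone _ _ *%R _)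
               (GRing.Scale.Law.clone _ _ (idfun \; *%R) _) Bd.
Proof.
split=> [v|u] a x y; rewrite /Bd /=.
  by rewrite linearP add_lfunE scale_lfunE mulrDr addrACA.
by rewrite linearP add_lfunE scale_lfunE mulrDr addrACA.
Qed.

HB.instance Definition _ :=
  bilinear_isBilinear.Build K D D K _ _ Bd Bd_bilinear.

Lemma Bd_sym (u v : D) : Bd u v = (-1) ^+ false * idfun (Bd v u).
Proof. by rewrite expr0 mul1r /Bd /= addrC. Qed.

HB.instance Definition _ :=
  isHermitianSesquilinear.Build K D false idfun Bd Bd_sym.

Definition in_space (x : A) : D := (x, 0).
Definition in_dual (a : A') : D := (0, a).

Record permManinTriple := PermManinTriple {
  pmt_double : permAlgebra D;
  pmt_space : permAlgebra A;
  pmt_dual : permAlgebra A';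
  pmt_space_sub :
    mul_compat in_space (perm_mul pmt_space) (perm_mul pmt_double);
  pmt_dual_sub :
    mul_compat in_dual (perm_mul pmt_dual) (perm_mul pmt_double);
  pmt_left_invariant : left_invariant (perm_mul pmt_double) Bd }.

Record specialApreManinTriple := SpecialApreManinTriple {
  amt_double : specialApre D;
  amt_space : specialApre A;
  amt_dual : specialApre A';
  amt_space_sub :
    mul_compat in_space (rtri amt_space) (rtri amt_double) /\
    mul_compat in_space (ltri amt_space) (ltri amt_double);
  amt_dual_sub :
    mul_compat in_dual (rtri amt_dual) (rtri amt_double) /\
    mul_compat in_dual (ltri amt_dual) (ltri amt_double);
  amt_quadratic : quadratic amt_double Bd }.
End Double.

(* Main.v *)
Require Import Defs.
From HB Require Import structures.
From mathcomp Require Import all_boot all_order all_algebra.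
From mathcomp Require Import sesquilinear.
From Stdlib Require Import ProofIrrelevance.

Set Implicit Arguments.
Unset Strict Implicit.
Unset Printing Implicit Defensive.

(** Write o for the sum of the two triangles of a special apre-perm algebra
and l for its left-pointing triangle.  The correspondence keeps o and forgets
the splitting of o as r + l; the point is that a nondegenerate symmetric form
B recovers the splitting.

In one direction, commutativity of l turns the invariance
B (l x y) z = - B x (o z y) into the left-invariance of o, because its left
side is symmetric in x and y ([apre_invariant_left]).  In the other direction,
invariance can be read as a definition: as B identifies the space with its
dual, there is exactly one l with B (l x y) z = - B x (o z y), which is
[adjoint_mul].  Left-invariance of o makes this l commutative, so with
r = o - l the bullet operation r x y + l y x collapses to o
([bullet_sub]).  Each apre-perm axiom then either is a perm axiom or, paired
with an arbitrary vector through B, becomes one ([adjoint_mul_apre]).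

For a Manin triple this is applied to B_d on the double.  Each of the two
summands is its own orthogonal space: for x, y, z in the same summand,
B_d (l x y) z = - B_d x (o z y) = 0, because o z y lies in that summand, hence
l x y lies there as well ([space_ltri_sub], [dual_ltri_sub]).  So both
summands inherit the apre-perm structure.  The two passages are mutually inverse because either
kind of triple is determined by o on the double: the structures on the
summands are restrictions, and l is determined by o and B_d
([permManinTriple_eq], [specialApreManinTriple_eq]). *)

Import GRing.Theory.
Local Open Scope ring_scope.

(** * Linear maps given by functions *)

Section LinearMaps.
Variable (K : fieldType).

Lemma linfunE_linear (U V : vectType K) (f : U -> V) : linear f -> linfun f =1 f.
Proof.
move=> lin_f; pose f_lin := GRing.isLinear.Build K U V *:%R f lin_f.
exact: (lfunE (HB.pack_for {linear U -> V} f f_lin)).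
Qed.

Variables U V W : vectType K.

Definition linfun2 (m : U -> V -> W) : 'Hom(U, 'Hom(V, W)) :=
  linfun (fun x => linfun (m x)).

Lemma linfun2E (m : U -> V -> W) :
    (forall x, linear (m x)) -> (forall y, linear (m^~ y)) ->
  forall x y, linfun2 m x y = m x y.
Proof.
move=> linr linl x y; rewrite /linfun2.
suff lin_m : linear (fun u => linfun (m u)) by rewrite !linfunE_linear.
move=> a u v; apply/lfunP=> z; rewrite add_lfunE scale_lfunE !linfunE_linear //.
exact: linl.
Qed.

Lemma lfun2_eq (m n : 'Hom(U, 'Hom(V, W))) :
  (forall x y, m x y = n x y) -> m = n.
Proof. by move=> eq_mn; apply/lfunP=> x; apply/lfunP=> y; apply: eq_mn. Qed.
End LinearMaps.

Section Mul.
Variables (K : fieldType) (V : vectType K) (m : 'Mul(V)).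

Lemma assoc_mul_sub (l : 'Mul(V)) : assoc_mul (m - l) l = m.
Proof. exact: subrK. Qed.

Lemma mulDl x y z : m (x + y) z = m x z + m y z.
Proof. by rewrite linearD add_lfunE. Qed.

Lemma mul_subE (n : 'Mul(V)) x y : (m - n) x y = m x y - n x y.
Proof. by rewrite !(add_lfunE, opp_lfunE). Qed.

Lemma mulZl a x z : m (a *: x) z = a *: m x z.
Proof. by rewrite linearZ scale_lfunE. Qed.
End Mul.

(** * Left-invariant and invariant forms *)

Section Form.
Variables (K : fieldType) (V : vectType K) (B : {symmetric V}).
Implicit Types (o l : 'Mul(V)) (x y z u v : V).

Lemma bformC x y : B x y = B y x.
Proof. by rewrite hermC expr0 mul1r. Qed.

Lemma bformPl a u v z : B (a *: u + v) z = a * B u z + B v z.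
Proof. exact: linearPl. Qed.

Lemma bformPr a u v z : B z (a *: u + v) = a * B z u + B z v.
Proof. exact: linearPr. Qed.

Lemma bformNl u z : B (- u) z = - B u z.
Proof. exact: linearNl. Qed.

Hypothesis ndB : nondegenerate B.

Lemma nondegenerate_inj u v : (forall z, B u z = B v z) -> u = v.
Proof.
move=> eqB; apply/eqP; rewrite -subr_eq0 -memv0 -(eqP ndB).
apply/mem_orthovP=> z _.
by rewrite -[u]scale1r bformPl bformNl eqB mul1r subrr.
Qed.

(** The musical isomorphism from V to its dual induced by the form. *)
Definition flat : 'Hom(V, 'Hom(V, K^o)) := linfun2 (B : V -> V -> K^o).

Lemma flatE x y : flat x y = B x y.
Proof.
by apply: linfun2E => [z|z] a u v; [apply: bformPr | apply: bformPl].
Qed.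

(** An injective map between spaces of equal dimension is onto, so every
functional is represented by a vector; this is where finite dimension
enters. *)
Lemma flat_surj : limg flat = fullv.
Proof.
have ker0 : lker flat = 0%VS.
  apply/eqP/lker0P => u v eq_uv; apply: nondegenerate_inj => z.
  by rewrite -!flatE eq_uv.
apply/eqP; rewrite eqEdim subvf limg_dim_eq; last by rewrite ker0 capv0.
by rewrite !dimvf /dim /= muln1.
Qed.

Definition riesz (phi : V -> K) : V := (flat^-1)%VF (linfun (phi : V -> K^o)).

Lemma rieszE (phi : V -> K^o) z : linear phi -> B (riesz phi) z = phi z.
Proof.
move=> lin_phi; rewrite -flatE limg_lfunVK ?linfunE_linear //.
by rewrite flat_surj memvf.
Qed.

(** The invariance condition B (l x y) z = - B x (o z y), solved for l. *)
Definition adjoint_mul o : 'Mul(V) :=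
  linfun2 (fun x y => riesz (fun z => - B x (o z y))).

Lemma adjoint_mulE o x y z : B (adjoint_mul o x y) z = - B x (o z y).
Proof.
have adjE u v w : B (riesz (fun t => - B u (o t v))) w = - B u (o w v).
  apply: (rieszE (phi := fun t => - B u (o t v))) => a s t.
  by rewrite mulDl mulZl bformPr opprD scalerN.
rewrite linfun2E ?adjE // => u a v w; apply: nondegenerate_inj => t.
  by rewrite bformPl !adjE linearP bformPr opprD mulrN.
by rewrite bformPl !adjE bformPl opprD mulrN.
Qed.

Section FromPerm.
Variables (o : 'Mul(V)) (permo : perm_axiom o) (invo : left_invariant o B).
Let l := adjoint_mul o.

(** Moving z by left-invariance shows that B x (o z y) is symmetric in x
and y. *)
Lemma adjoint_mulC x y : l x y = l y x.
Proof.
by apply: nondegenerate_inj => z; rewrite !adjoint_mulE -invo bformC.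
Qed.

(** The mixed operation of the apre-perm axioms is o itself, since the two
contributions of l cancel by commutativity. *)
Lemma bullet_sub x y : bullet (o - l) l x y = o x y.
Proof.
by rewrite /bullet mul_subE adjoint_mulC subrK.
Qed.

(** The axioms on bullet alone are associativity and left commutativity of o.
The ones that involve l are tested against an arbitrary w: up to sign, every
side then becomes B z t with t a product of w, x and y whose last factor is y,
and in a perm algebra all these products agree. *)
Lemma adjoint_mul_apre : apre_perm_axiom (o - l) l.
Proof.
have permA x y z : o x (o y z) = o (o x y) z by case: (permo x y z).
have permC x y z : o (o x y) z = o (o y x) z by case: (permo x y z).
rewrite /apre_perm_axiom assoc_mul_sub; split=> // x y z.
rewrite !bullet_sub; split; rewrite ?permA //.
- apply: nondegenerate_inj => w.
  by rewrite bformNl !adjoint_mulE opprK permA.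
- apply: nondegenerate_inj => w.
  by rewrite bformNl invo !adjoint_mulE opprK -permA permC permA.
- by apply: nondegenerate_inj => w; rewrite invo !adjoint_mulE invo permA permC.
Qed.

Definition apre_of_perm : specialApre V :=
  SpecialApre adjoint_mul_apre adjoint_mulC.
End FromPerm.

(** Invariance expresses B x (o z y) through l x y, which is symmetric in x
and y; symmetry of B then moves z across. *)
Lemma apre_invariant_left (P : specialApre V) :
  apre_invariant P B -> left_invariant (circ P) B.
Proof.
move=> invP x y z; apply: oppr_inj.
by rewrite [B (circ _ _ _) _]bformC -!invP ltri_comm.
Qed.

Lemma eq_ltri (P Q : specialApre V) :
    apre_invariant P B -> apre_invariant Q B -> circ P = circ Q ->
  ltri P = ltri Q.
Proof.
move=> invP invQ eqPQ; apply: lfun2_eq => x y; apply: nondegenerate_inj => z.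
by rewrite invP invQ eqPQ.
Qed.
End Form.

(** * Extensionality of the algebra records *)

Section Records.
Variables (K : fieldType) (V : vectType K).

Lemma permAlgebra_eq (P Q : permAlgebra V) : perm_mul P = perm_mul Q -> P = Q.
Proof.
case: P Q => [o oP] [o' oP'] /= eqo; rewrite -{}eqo in oP' *.
by rewrite (proof_irrelevance _ oP oP').
Qed.

Lemma specialApre_eq (P Q : specialApre V) :
  circ P = circ Q -> ltri P = ltri Q -> P = Q.
Proof.
case: P Q => [r l ax lC] [r' l' ax' lC'] /= + eql.
rewrite -{}eql in ax' lC' * => /addIr /= eqr; rewrite -{}eqr in ax' *.
by rewrite (proof_irrelevance _ ax ax') (proof_irrelevance _ lC lC').
Qed.
End Records.

(** * Pulling structure back along an embedding *)

Section Restrict.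
Variables (K : fieldType) (U V : vectType K) (i : U -> V).
Hypotheses (i_lin : linear i) (i_inj : injective i).

Lemma embD x y : i (x + y) = i x + i y.
Proof. by rewrite -[x]scale1r i_lin !scale1r. Qed.

Lemma embN x : i (- x) = - i x.
Proof.
have i0 : i 0 = 0 by apply: (addrI (i 0)); rewrite -embD !addr0.
by apply: (addrI (i x)); rewrite -embD !subrr.
Qed.

Lemma mul_compatD (m n : 'Mul(U)) (m' n' : 'Mul(V)) :
  mul_compat i m m' -> mul_compat i n n' -> mul_compat i (m + n) (m' + n').
Proof. by move=> cm cn x y; rewrite !add_lfunE embD cm cn. Qed.

Lemma mul_compatB (m n : 'Mul(U)) (m' n' : 'Mul(V)) :
  mul_compat i m m' -> mul_compat i n n' -> mul_compat i (m - n) (m' - n').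
Proof.
by move=> cm cn x y; rewrite !mul_subE embD embN cm cn.
Qed.

Lemma mul_compat_inj (m n : 'Mul(U)) (m' : 'Mul(V)) :
  mul_compat i m m' -> mul_compat i n m' -> m = n.
Proof. by move=> cm cn; apply: lfun2_eq => x y; apply: i_inj; rewrite cm cn. Qed.

(** The apre-perm axioms are identities, so they hold on a subspace closed
under both multiplications. *)
Lemma subalgebra_apre (r l : 'Mul(U)) (r' l' : 'Mul(V)) :
    mul_compat i r r' -> mul_compat i l l' ->
  apre_perm_axiom r' l' -> apre_perm_axiom r l.
Proof.
move=> cr cl [perm' ax'].
have co := mul_compatD cr cl; rewrite -/(assoc_mul r l) in co.
have cb x y : i (bullet r l x y) = bullet r' l' (i x) (i y).
  by rewrite embD cr cl.
split=> [x y z|x y z].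
  by have [? ?] := perm' (i x) (i y) (i z); split; apply: i_inj; rewrite !co.
have := ax' (i x) (i y) (i z).
by case=> *; split; apply: i_inj; rewrite ?(embN, cb, cl, co).
Qed.

(** Closure of the image of i under m is phrased through a projection p, which
also supplies the restricted multiplication. *)
Lemma restrict_mul (p : {linear V -> U}) (m : 'Mul(V)) :
    (forall x y, i (p (m (i x) (i y))) = m (i x) (i y)) ->
  mul_compat i (linfun2 (fun x y => p (m (i x) (i y)))) m.
Proof.
move=> stable x y; rewrite linfun2E ?stable // => z a u v.
  by rewrite i_lin !linearP.
by rewrite i_lin mulDl mulZl linearP.
Qed.
End Restrict.

(** * Manin triples on the double *)

Section Double.
Variables (K : fieldType) (A : vectType K).
Local Notation A' := 'Hom(A, K^o).
Local Notation D := (A * A')%type.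
Implicit Types (u : D).

Lemma dual_separates (x : A) : (forall a : A', a x = 0) -> x = 0.
Proof.
move=> x0; rewrite (coord_vbasis (memvf x)) big1 // => i _.
have := x0 (linfun (coord (vbasis fullv) i : A -> K^o)).
by rewrite lfunE /= => ->; rewrite scale0r.
Qed.

(** This and the next lemma say that each summand contains its own
orthogonal space. *)
Lemma Bd_space_orth u : (forall y, Bd u (in_space y) = 0) -> u.2 = 0.
Proof.
move=> u0; apply/lfunP=> y; rewrite zero_lfunE.
by have := u0 y; rewrite /Bd /= zero_lfunE add0r.
Qed.

Lemma Bd_dual_orth u : (forall b, Bd u (in_dual b) = 0) -> u.1 = 0.
Proof.
move=> u0; apply: dual_separates => b.
by have := u0 b; rewrite /Bd /= linear0 addr0.
Qed.

Lemma Bd_nondegenerate : nondegenerate (@Bd K A).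
Proof.
apply/eqP/vspaceP => u; rewrite memv0; apply/mem_orthovP/eqP => [u0|-> v _].
  case: u u0 => x a u0; congr (_, _).
    by apply: (@Bd_dual_orth (x, a)) => b; apply: u0; rewrite memvf.
  by apply: (@Bd_space_orth (x, a)) => y; apply: u0; rewrite memvf.
exact: linear0l.
Qed.

Lemma in_space_linear : linear (@in_space K A).
Proof. by move=> a x y; congr (_, _); rewrite /= scaler0 addr0. Qed.

Lemma in_dual_linear : linear (@in_dual K A).
Proof. by move=> a x y; congr (_, _); rewrite /= scaler0 addr0. Qed.

Lemma in_space_inj : injective (@in_space K A).
Proof. by move=> x y []. Qed.

Lemma in_dual_inj : injective (@in_dual K A).
Proof. by move=> x y []. Qed.

Lemma Bd_space_isotropic x y : Bd (@in_space K A x) (in_space y) = 0.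
Proof. by rewrite /Bd /= !zero_lfunE addr0. Qed.

Lemma Bd_dual_isotropic a b : Bd (@in_dual K A a) (in_dual b) = 0.
Proof. by rewrite /Bd /= !linear0 addr0. Qed.

Section PermToApre.
Variable T : permManinTriple A.
Let o := perm_mul (pmt_double T).
Let l := adjoint_mul (@Bd K A) o.
Let adjE := adjoint_mulE Bd_nondegenerate o.

Definition double_apre : specialApre D :=
  apre_of_perm Bd_nondegenerate (perm_mulP (pmt_double T))
    (pmt_left_invariant T).

Definition space_ltri : 'Mul(A) :=
  linfun2 (fun x y => (l (in_space x) (in_space y)).1).
Definition dual_ltri : 'Mul(A') :=
  linfun2 (fun a b => (l (in_dual a) (in_dual b)).2).

(** By [adjoint_mulE] a product of two vectors of A is orthogonal to A: the
perm product keeps A stable and A is isotropic.  Its component in the dual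
therefore vanishes. *)
Lemma space_ltri_sub : mul_compat (@in_space K A) space_ltri l.
Proof.
apply: (restrict_mul in_space_linear (p := fst)) => x y.
rewrite [RHS]surjective_pairing; congr (_, _); apply/esym/Bd_space_orth => z.
by rewrite adjE -(pmt_space_sub T) -[RHS]oppr0; congr (- _); apply: Bd_space_isotropic.
Qed.

Lemma dual_ltri_sub : mul_compat (@in_dual K A) dual_ltri l.
Proof.
apply: (restrict_mul in_dual_linear (p := snd)) => a b.
rewrite [RHS]surjective_pairing; congr (_, _); apply/esym/Bd_dual_orth => c.
by rewrite adjE -(pmt_dual_sub T) -[RHS]oppr0; congr (- _); apply: Bd_dual_isotropic.
Qed.

Let space_rtri_sub :=
  mul_compatB in_space_linear (pmt_space_sub T) space_ltri_sub.
Let dual_rtri_sub :=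
  mul_compatB in_dual_linear (pmt_dual_sub T) dual_ltri_sub.

Lemma space_ltri_comm x y : space_ltri x y = space_ltri y x.
Proof.
apply: in_space_inj; rewrite !space_ltri_sub.
exact: (ltri_comm double_apre).
Qed.

Lemma dual_ltri_comm a b : dual_ltri a b = dual_ltri b a.
Proof.
apply: in_dual_inj; rewrite !dual_ltri_sub.
exact: (ltri_comm double_apre).
Qed.

Definition space_apre : specialApre A :=
  SpecialApre (subalgebra_apre in_space_linear in_space_inj space_rtri_sub
    space_ltri_sub (specialApre_axiom double_apre)) space_ltri_comm.
Definition dual_apre : specialApre A' :=
  SpecialApre (subalgebra_apre in_dual_linear in_dual_inj dual_rtri_sub
    dual_ltri_sub (specialApre_axiom double_apre)) dual_ltri_comm.

Lemma circ_double_apre : circ double_apre = o.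
Proof. exact: assoc_mul_sub. Qed.

Lemma double_apre_quadratic : quadratic double_apre (@Bd K A).
Proof.
split=> [|x y z]; first exact: Bd_nondegenerate.
by rewrite circ_double_apre; apply: adjE.
Qed.

Definition apre_triple_of_perm : specialApreManinTriple A :=
  SpecialApreManinTriple (amt_double := double_apre)
    (amt_space := space_apre) (amt_dual := dual_apre)
    (conj space_rtri_sub space_ltri_sub) (conj dual_rtri_sub dual_ltri_sub)
    double_apre_quadratic.
End PermToApre.

Definition perm_of_apre (V : vectType K) (P : specialApre V) : permAlgebra V :=
  PermAlgebra (proj1 (specialApre_axiom P)).

Section ApreToPerm.
Variable T : specialApreManinTriple A.

Lemma circ_space_sub :
  mul_compat (@in_space K A) (circ (amt_space T)) (circ (amt_double T)).
Proof.
have [cr cl] := amt_space_sub T.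
exact (mul_compatD in_space_linear cr cl).
Qed.

Lemma circ_dual_sub :
  mul_compat (@in_dual K A) (circ (amt_dual T)) (circ (amt_double T)).
Proof.
have [cr cl] := amt_dual_sub T.
exact (mul_compatD in_dual_linear cr cl).
Qed.

Definition perm_triple_of_apre : permManinTriple A :=
  PermManinTriple (pmt_double := perm_of_apre (amt_double T))
    (pmt_space := perm_of_apre (amt_space T))
    (pmt_dual := perm_of_apre (amt_dual T))
    circ_space_sub circ_dual_sub (apre_invariant_left (proj2 (amt_quadratic T))).
End ApreToPerm.

(** The embeddings of the summands are injective, so the double determines
the perm structures on them. *)
Lemma permManinTriple_eq (S T : permManinTriple A) :
  perm_mul (pmt_double S) = perm_mul (pmt_double T) -> S = T.
Proof.
case: S T => [d s a cs ca inv] [d' s' a' cs' ca' inv'] /= /permAlgebra_eq eqd.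
rewrite -{}eqd in cs' ca' inv' *.
have eqs := permAlgebra_eq (mul_compat_inj in_space_inj cs cs').
have eqa := permAlgebra_eq (mul_compat_inj in_dual_inj ca ca').
rewrite -{}eqs in cs' *; rewrite -{}eqa in ca' *.
by congr PermManinTriple; apply: proof_irrelevance.
Qed.

Lemma specialApre_sub_eq (U V : vectType K) (i : U -> V) (P Q : specialApre U)
    (d : specialApre V) :
    injective i ->
    mul_compat i (rtri P) (rtri d) /\ mul_compat i (ltri P) (ltri d) ->
    mul_compat i (rtri Q) (rtri d) /\ mul_compat i (ltri Q) (ltri d) ->
  P = Q.
Proof.
move=> i_inj [crP clP] [crQ clQ].
have eqr := mul_compat_inj i_inj crP crQ.
have eql := mul_compat_inj i_inj clP clQ.
by apply: specialApre_eq => //; rewrite /circ eqr eql.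
Qed.

(** Invariance of the nondegenerate B_d recovers the left-pointing triangle
of the double from the perm product, hence the other triangle and the two
subalgebras as well. *)
Lemma specialApreManinTriple_eq (S T : specialApreManinTriple A) :
  circ (amt_double S) = circ (amt_double T) -> S = T.
Proof.
case: S T => [d s a cs ca q] [d' s' a' cs' ca' q'] /= eqo.
have eqd : d = d'.
  have [[_ inv] [_ inv']] := (q, q').
  exact: specialApre_eq eqo (eq_ltri Bd_nondegenerate inv inv' eqo).
rewrite -{}eqd {d' eqo} in cs' ca' q' *.
have eqs := specialApre_sub_eq in_space_inj cs cs'.
have eqa := specialApre_sub_eq in_dual_inj ca ca'.
rewrite -{}eqs in cs' *; rewrite -{}eqa in ca' *.
by congr SpecialApreManinTriple; apply: proof_irrelevance.
Qed.
End Double.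

Theorem proposition4p2 (K : closedFieldType) (charK0 : [pchar K] =i pred0)
    (A : vectType K) :
  exists f : specialApreManinTriple A -> permManinTriple A,
    bijective f /\
    forall T : specialApreManinTriple A,
      [/\ perm_mul (pmt_double (f T)) = circ (amt_double T),
          perm_mul (pmt_space (f T)) = circ (amt_space T)
        & perm_mul (pmt_dual (f T)) = circ (amt_dual T)].
Proof.
exists (@perm_triple_of_apre K A); split=> //.
exists (@apre_triple_of_perm K A) => T.
  apply: specialApreManinTriple_eq; exact: circ_double_apre.
apply: permManinTriple_eq; exact: circ_double_apre.
Qed.
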